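(* Let $\mathcal{H}$ be a real Hilbert space, let $\mathcal{A}:\mathcal{H}\to2^{\mathcal{H}}$ be a maximal monotone operator with $\operatorname{zer}(\mathcal{A})\neq\emptyset$, and let $\mathcal{M}$ be an admissible preconditioner for $\mathcal{A}$ with a decomposition $\mathcal{M}=\mathcal{C}\mathcal{C}^*$ such that $(\mathcal{M}+\mathcal{A})^{-1}$ is $L$-Lipschitz continuous. Let $\{x^k\}$ be the sequence generated by the PHA iteration with $T=(\mathcal{M}+\mathcal{A})^{-1}\mathcal{M}$ and anchoring parameters $\varphi_k$, and let $x^*$ be an arbitrary point of $\operatorname{zer}(\mathcal{A})$. Then (i) $\displaystyle \|x^k-Tx^k\|_{\mathcal{M}}\le\frac{2}{\varphi_k+1}\|x^0-x^*\|_{\mathcal{M}}$ for all $k\ge1$; (ii) $\displaystyle \|x^k-Tx^k\|\le\frac{M(L'+1)}{\varphi_k+1}+\frac{2L'}{\varphi_{k-1}+1}\|x^0-x^*\|_{\mathcal{M}}$ for all $k\ge2$, where $M=\sup_{k\ge1}\max\{\|x^0-x^k\|_{\mathcal{M}},\ \|x^0-Tx^k\|\}$ and $L'=L\|\mathcal{C}\|$.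
   Context: Notation: $\operatorname{zer}(\mathcal{A})=\{x\in\mathcal{H}:0\in\mathcal{A}x\}$; $\langle x,y\rangle_{\mathcal{M}}=\langle \mathcal{M}x,y\rangle$; $\|x\|_{\mathcal{M}}=\sqrt{\langle x,x\rangle_{\mathcal{M}}}$. An admissible preconditioner for $\mathcal{A}$ is a linear, bounded, self-adjoint, positive semidefinite operator $\mathcal{M}:\mathcal{H}\to\mathcal{H}$ such that $(\mathcal{M}+\mathcal{A})^{-1}\mathcal{M}$ is single-valued and has full domain. In a decomposition $\mathcal{M}=\mathcal{C}\mathcal{C}^*$, $\mathcal{C}:\mathcal{D}\to\mathcal{H}$ is a bounded, injective linear operator from some real Hilbert space $\mathcal{D}$. $L$-Lipschitz continuity of $(\mathcal{M}+\mathcal{A})^{-1}$ (on its domain) means $\|a-b\|\le L\|x-y\|$ whenever $a\in(\mathcal{M}+\mathcal{A})^{-1}x$ and $b\in(\mathcal{M}+\mathcal{A})^{-1}y$. PHA iteration (preconditioned Halpern iteration with adaptive anchoring parameters): given $x^0\in\mathcal{H}$, for $k=1,2,\dots$ set $$x^k=\frac{1}{\varphi_k+1}x^0+\frac{\varphi_k}{\varphi_k+1}Tx^{k-1},\qquad \varphi_k=\frac{2\langle x^{k-1}-Tx^{k-1},\,x^0-x^{k-1}\rangle_{\mathcal{M}}}{\|x^{k-1}-Tx^{k-1}\|_{\mathcal{M}}^2}+1.$$ It is assumed that $\|x^{k-1}-Tx^{k-1}\|_{\mathcal{M}}\neq 0$ for every $k\ge1$, so that all $\varphi_k$ are defined and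 the iteration produces an infinite sequence. *)

(* Defs.v *)
From HB Require Import structures.
From mathcomp Require Import all_boot all_order all_algebra.
From mathcomp Require Import all_classical all_reals all_analysis.

Set Implicit Arguments.
Unset Strict Implicit.
Unset Printing Implicit Defensive.

Import Order.TTheory GRing.Theory Num.Theory.
Import numFieldNormedType.Exports.

Local Open Scope classical_set_scope.
Local Open Scope ring_scope.

HB.mixin Record CompleteNormedModule_isHilbert (R : realType) H
    of CompleteNormedModule R H := {
  inner : {dot H for @idfun R} ;
  inner_normE : forall x : H, inner x x = `|x| ^+ 2
}.

#[short(type="hilbertType")]
HB.structure Definition Hilbert (R : realType) :=
  { H of CompleteNormedModule_isHilbert R H & CompleteNormedModule R H }.

Notation "''<' x , y '>'" := (inner x y)
  (at level 8, x at level 69, y at level 69, format "''<' x ,  y '>'")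
  : ring_scope.

Section SetValuedOperators.
Variables (R : realType) (H : hilbertType R).
Implicit Types (A B : H -> set H) (M T : H -> H).

Definition monotone_op A :=
  forall x y u v, A x u -> A y v -> 0 <= '<x - y, u - v>.

Definition maximal_monotone A := monotone_op A /\
  forall B, monotone_op B -> (forall x, A x `<=` B x) ->
    forall x, B x `<=` A x.

Definition zer A : set H := [set x | A x 0].

Definition add_op M A (x : H) : set H := [set M x + u | u in A x].

Definition inv_op B (y : H) : set H := [set x | B x y].

Definition lipschitz_op (L : R) B :=
  forall x y a b, B x a -> B y b -> `|a - b| <= L * `|x - y|.

End SetValuedOperators.

Section Preconditioners.
Variables (R : realType) (H : hilbertType R).
Implicit Types (A : H -> set H) (M : {linear H -> H}).

Definition admissible_preconditioner A M :=
  [/\ bounded_fun_norm M,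
      (forall x y, '<M x, y> = '<x, M y>),
      (forall x, 0 <= '<M x, x>),
      (forall x, is_subset1 (inv_op (add_op M A) (M x))) &
      (forall x, inv_op (add_op M A) (M x) !=set0)].

Definition minner M (x y : H) : R := '<M x, y>.

Definition mnorm M (x : H) : R := Num.sqrt (minner M x x).

Definition op_norm (D : hilbertType R) (C : {linear D -> H}) : R :=
  sup [set `|C d| | d in [set d | `|d| <= 1]].

(* Bounded operators between Hilbert spaces have exactly one adjoint, so
   [Cs] below is the operator C^*. *)
Definition is_adjoint (D : hilbertType R) (C : {linear D -> H})
  (Cs : {linear H -> D}) := forall d h, '<C d, h> = '<d, Cs h>.

Definition is_decomposition (D : hilbertType R) M (C : {linear D -> H})
    (Cs : {linear H -> D}) :=
  [/\ bounded_fun_norm C, injective C, is_adjoint C Cs &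
      forall x, M x = C (Cs x)].

End Preconditioners.

Section PHA.
Variables (R : realType) (H : hilbertType R).
Variables (M : {linear H -> H}) (T : H -> H) (x : nat -> H).

(* Meaningful for 1 <= k only; the value at k = 0 is never used. *)
Definition pha_param (k : nat) : R :=
  2 * minner M (x k.-1 - T (x k.-1)) (x 0%N - x k.-1)
    / mnorm M (x k.-1 - T (x k.-1)) ^+ 2 + 1.

Definition pha_defined :=
  forall k, (1 <= k)%N -> mnorm M (x k.-1 - T (x k.-1)) != 0.

Definition pha_iteration := forall k, (1 <= k)%N ->
  x k = (1 / (pha_param k + 1)) *: x 0%N
        + (pha_param k / (pha_param k + 1)) *: T (x k.-1).

(* [sup] on R is 0 for unbounded sets; this set is bounded when
   (M + A)^-1 is Lipschitz and zer A is nonempty. *)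
Definition pha_bound : R :=
  sup [set Num.max (mnorm M (x 0%N - x k)) `|x 0%N - T (x k)|
      | k in [set k | (1 <= k)%N]].

End PHA.

(* Main.v *)
Require Import Defs.
From mathcomp Require Import all_boot all_order all_algebra.
From mathcomp Require Import all_classical all_reals all_analysis.
From mathcomp Require Import ring lra.

Set Implicit Arguments.
Unset Strict Implicit.
Unset Printing Implicit Defensive.

Import Order.TTheory GRing.Theory Num.Theory.
Import numFieldNormedType.Exports.

Local Open Scope classical_set_scope.
Local Open Scope ring_scope.

(** Nonexpansiveness is only ever needed for the seminorm of [M], and the
    decomposition [M = C C^*] turns that seminorm into a genuine norm:
    [<M x, y> = <C^* x, C^* y>], so [|x|_M = |C^* x|].  Monotonicity of [A]
    makes [T] firmly nonexpansive for [<., .>_M], and the zeros of [A] are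
    fixed points of [T].  Hence the images [u k = C^* (x k)] and
    [v k = C^* (T (x k))] form a Halpern iteration with adaptive anchoring in
    [D], and bound (i) is a statement about such iterations
    ([halpern_residual_le]).

    With [e k = u k - v k], the anchoring parameter is chosen exactly so that
    [(phi k - 1) * |e k.-1|^2 = 2 <e k.-1, u 0 - u k.-1>].  Nonexpansiveness
    propagates this equality to the inequality
    [phi k * |e k|^2 <= 2 <e k, u 0 - u k>] ([anchored_step]), which in turn
    says that [phi k.+1 >= phi k + 1].  Nonexpansiveness towards a fixed point
    [p] gives [|e k|^2 <= 2 <e k, u k - p>]; the sum of the two is
    [(phi k + 1) * |e k|^2 <= 2 <e k, u 0 - p>], and Cauchy-Schwarz yields (i).

    For (ii), [x k] is an average of [x 0] and [T (x k.-1)], so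
    [x k - T (x k)] is an average of [x 0 - T (x k)] and
    [T (x k.-1) - T (x k)].  The Lipschitz hypothesis gives
    [|T y - T z| <= L' * |y - z|_M]; writing [x k - x k.-1] as an average once
    more brings in [|x k.-1 - T (x k.-1)|_M], to which (i) applies.  The
    supremum [pha_bound] is meaningful because the iterates never get farther
    from a fixed point than [x 0] is. *)

(** * Inner products and operator norms *)

Section Inner.
Variables (R : realType) (H : hilbertType R).
Implicit Types x y z : H.

Lemma innerC x y : '<x, y> = '<y, x>.
Proof. by rewrite (hermC (@inner R H)) expr0 mul1r. Qed.

Lemma innerDr x y z : '<x, y + z> = '<x, y> + '<x, z>.
Proof. exact: linearDr. Qed.

Lemma innerDl x y z : '<y + z, x> = '<y, x> + '<z, x>.
Proof. exact: linearDl. Qed.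

Lemma innerNr x y : '<x, - y> = - '<x, y>.
Proof. exact: linearNr. Qed.

Lemma innerZr a x y : '<x, a *: y> = a * '<x, y>.
Proof. exact: linearZr. Qed.

Lemma innerBr x y z : '<x, y - z> = '<x, y> - '<x, z>.
Proof. by rewrite innerDr innerNr. Qed.

Lemma sqr_normD x y : `|x + y| ^+ 2 = `|x| ^+ 2 + 2 * '<x, y> + `|y| ^+ 2.
Proof.
by rewrite -!inner_normE innerDr !innerDl (innerC y x); ring.
Qed.

Lemma sqr_normB x y : `|x - y| ^+ 2 = `|x| ^+ 2 - 2 * '<x, y> + `|y| ^+ 2.
Proof. by rewrite sqr_normD innerNr normrN; ring. Qed.

(** Since the norm of [H] is a norm by fiat, Cauchy-Schwarz is just its
    triangle inequality squared. *)
Lemma inner_le_norm x y : '<x, y> <= `|x| * `|y|.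
Proof.
have := lerXn2r 2 (normr_ge0 _) (addr_ge0 (normr_ge0 x) (normr_ge0 y))
  (ler_normD x y).
by rewrite sqr_normD; nra.
Qed.

End Inner.

(** The weights of a Halpern step sum to one, so the distance to any point is
    at most the average of the distances. *)
Lemma norm_average_le (R : realType) (V : normedModType R) (s : R)
  (a b c : V) : 0 <= s ->
  `|(1 / (s + 1)) *: a + (s / (s + 1)) *: b - c|
    <= (`|a - c| + s * `|b - c|) / (s + 1).
Proof.
move=> s0; have s1 : 0 < s + 1 by lra.
have -> : (1 / (s + 1)) *: a + (s / (s + 1)) *: b - c
    = (1 / (s + 1)) *: (a - c) + (s / (s + 1)) *: (b - c).
  rewrite !scalerBr addrACA -opprD -scalerDl -mulrDl [1 + s]addrC.
  by rewrite divff ?gt_eqF// scale1r.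
apply: le_trans (ler_normD _ _) _.
rewrite (normrZ _ (a - c)) (normrZ _ (b - c)) !ger0_norm ?divr_ge0 ?(ltW s1)//.
by rewrite mul1r mulrDl [_^-1 * _]mulrC mulrAC.
Qed.

(** The supremum defining [op_norm] runs over a bounded set, so it does
    dominate the values of [C] on the unit ball. *)
Lemma op_norm_ge (R : realType) (D H : hilbertType R) (C : {linear D -> H})
  (d : D) : bounded_fun_norm C -> `|C d| <= op_norm C * `|d|.
Proof.
move=> bC; have [->|d0] := eqVneq d 0; first by rewrite linear0 !normr0 mulr0.
have nd : 0 < `|d| by rewrite normr_gt0.
have [B hB] := bC 1.
have : `|C (`|d|^-1 *: d)| <= op_norm C.
  apply: ub_le_sup; first by exists B => _ [z hz <-]; exact: hB.
  exists (`|d|^-1 *: d) => //=.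
  by rewrite normrZ normfV normr_id mulVf// gt_eqF.
by rewrite linearZ/= normrZ normfV normr_id ler_pdivrMl// mulrC.
Qed.

Lemma op_norm_ge0 (R : realType) (D H : hilbertType R) (C : {linear D -> H}) :
  bounded_fun_norm C -> 0 <= op_norm C.
Proof.
move=> bC; have [B hB] := bC 1.
rewrite -(normr0 H) -(linear0 C); apply: ub_le_sup.
  by exists B => _ [z hz <-]; exact: hB.
by exists 0 => //=; rewrite normr0.
Qed.

(** * Halpern iterations with adaptive anchoring *)

Section Halpern.
Variables (R : realType) (H : hilbertType R).

(** One iteration from [a] (with image [ta]) to [u] (with image [tu]), with
    parameter [s].  Put [w = u - ta]; then [u0 - u = s *: w], the hypothesis on
    the previous residual amounts to [|a - ta|^2 = 2 <a - ta, w>], the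
    conclusion to [|u - tu|^2 <= 2 <u - tu, w>], and nonexpansiveness compares
    [w - (u - tu) = tu - ta] with [w - (a - ta) = u - a]. *)
Lemma anchored_step (u0 a ta u tu : H) (s : R) : 0 <= s ->
  u = (1 / (s + 1)) *: u0 + (s / (s + 1)) *: ta ->
  (s - 1) * `|a - ta| ^+ 2 = 2 * '<a - ta, u0 - a> ->
  `|tu - ta| <= `|u - a| ->
  s * `|u - tu| ^+ 2 <= 2 * '<u - tu, u0 - u>.
Proof.
move=> s0 hu ha hne.
have s1 : s + 1 != 0 by rewrite gt_eqF// ltr_wpDl.
set f := a - ta; set e := u - tu; set w := u - ta.
have u0E : u0 = (s + 1) *: w + ta.
  rewrite /w hu scalerBr scalerDr !scalerA.
  rewrite [_ * (1 / _)]mulrC divfK// [_ * (s / _)]mulrC divfK// scale1r.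
  by rewrite scalerDl scale1r opprD !addrA addrK addrNK.
have u0u : u0 - u = s *: w.
  by rewrite {1}u0E scalerDl scale1r -[_ + w + ta]addrA addrNK addrK.
have u0a : u0 - a = (s + 1) *: w - f.
  by rewrite u0E /f opprB addrA.
have ff : `|f| ^+ 2 = 2 * '<f, w>.
  move: ha; rewrite -/f u0a innerBr innerZr inner_normE => ha.
  by apply: (mulfI s1); lra.
have ww : `|w - e| ^+ 2 <= `|w - f| ^+ 2.
  rewrite lerXn2r ?nnegrE// /w /e /f.
  have -> : u - ta - (u - tu) = tu - ta.
    by rewrite opprB addrC addrA addrNK.
  suff -> : u - ta - (a - ta) = u - a by [].
  by rewrite opprB addrA addrNK.
move: ww; rewrite !(sqr_normB w) (innerC w e) (innerC w f) => ww.
by rewrite u0u innerZr [leRHS]mulrCA ler_wpM2l//; lra.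
Qed.

Variables (u v : nat -> H) (phi : nat -> R) (p : H).
Hypothesis residual_neq0 : forall k, `|u k - v k| != 0.
Hypothesis phiE : forall k,
  phi k.+1 = 2 * '<u k - v k, u 0%N - u k> / `|u k - v k| ^+ 2 + 1.
Hypothesis iterE : forall k,
  u k.+1 = (1 / (phi k.+1 + 1)) *: u 0%N
           + (phi k.+1 / (phi k.+1 + 1)) *: v k.
Hypothesis nonexpansive : forall j k, `|v j - v k| <= `|u j - u k|.
Hypothesis nonexpansive_fix : forall k, `|v k - p| <= `|u k - p|.

Lemma anchor_eq k :
  (phi k.+1 - 1) * `|u k - v k| ^+ 2 = 2 * '<u k - v k, u 0%N - u k>.
Proof. by rewrite phiE addrK divfK// expf_neq0. Qed.

Lemma anchor_ineq k : 0 <= phi k.+1 ->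
  phi k.+1 * `|u k.+1 - v k.+1| ^+ 2
    <= 2 * '<u k.+1 - v k.+1, u 0%N - u k.+1>.
Proof. by move=> h; apply: anchored_step h (iterE k) (anchor_eq k) _. Qed.

(** The parameters even grow by at least one at each step: compare
    [anchor_ineq] at [k] with [anchor_eq] at [k.+1]. *)
Lemma anchor_ge1 k : 1 <= phi k.+1.
Proof.
(* At the first step the numerator of the parameter vanishes: [phi 1 = 1]. *)
elim: k => [|k IHk]; first by rewrite phiE subrr linear0r mulr0 mul0r add0r.
have := anchor_ineq (le_trans ler01 IHk); rewrite -anchor_eq.
by rewrite ler_pM2r ?exprn_gt0 ?lt0r ?residual_neq0//=; lra.
Qed.

Lemma halpern_residual_le k :
  `|u k.+1 - v k.+1| <= 2 / (phi k.+1 + 1) * `|u 0%N - p|.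
Proof.
have phi1 := anchor_ge1 k; set e := u k.+1 - v k.+1.
have fix_ineq : `|e| ^+ 2 <= 2 * '<e, u k.+1 - p>.
  have : `|(u k.+1 - p) - e| ^+ 2 <= `|u k.+1 - p| ^+ 2.
    rewrite lerXn2r ?nnegrE// /e opprB addrC addrA addrNK.
    exact: nonexpansive_fix.
  by rewrite sqr_normB (innerC _ e); lra.
have := anchor_ineq (le_trans ler01 phi1); rewrite -/e => anc.
have cs := inner_le_norm e (u 0%N - p).
have split : '<e, u 0%N - p> = '<e, u 0%N - u k.+1> + '<e, u k.+1 - p>.
  by rewrite -innerDr addrA addrNK.
have e0 : 0 < `|e| by rewrite lt0r residual_neq0/=.
rewrite mulrAC ler_pdivlMr; last lra.
rewrite -(ler_pM2r e0); nra.
Qed.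

Lemma halpern_dist_le k : `|u k - p| <= `|u 0%N - p|.
Proof.
elim: k => // k IHk; have phi1 := anchor_ge1 k.
rewrite iterE; apply: le_trans (norm_average_le _ _ _ _) _; first lra.
have vp := le_trans (nonexpansive_fix k) IHk.
rewrite ler_pdivrMr; last lra.
by nra.
Qed.

End Halpern.

(** * The preconditioned operator *)

Section Preconditioned.
Variables (R : realType) (H D : hilbertType R).
Variables (A : H -> set H) (M : {linear H -> H}).
Variables (C : {linear D -> H}) (Cs : {linear H -> D}) (T : H -> H).
Hypothesis hT : forall z : H, inv_op (add_op M A) (M z) = [set T z].

Lemma resolvent_mem z : inv_op (add_op M A) (M z) (T z).
Proof. by rewrite hT. Qed.

Lemma resolvent_residual z : A (T z) (M z - M (T z)).
Proof. by have [w Aw <-] := resolvent_mem z; rewrite addrC addKr. Qed.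

Lemma zer_fixed p : zer A p -> T p = p.
Proof.
move=> Ap; have : inv_op (add_op M A) (M p) p by exists 0 => //; rewrite addr0.
by rewrite hT => /= /esym.
Qed.

Hypothesis hC : is_decomposition M C Cs.

Lemma minnerE y z : minner M y z = '<Cs y, Cs z>.
Proof. by case: hC => _ _ adjC ME; rewrite /minner ME adjC. Qed.

Lemma mnormE z : mnorm M z = `|Cs z|.
Proof. by rewrite /mnorm minnerE inner_normE sqrtr_sqr normr_id. Qed.

(** Monotonicity gives [|T y - T z|_M^2 <= <T y - T z, y - z>_M], and
    Cauchy-Schwarz (here in its weak form [2 <a, b> <= |a|^2 + |b|^2]) does the
    rest. *)
Lemma resolvent_nonexpansive : monotone_op A ->
  forall y z, `|Cs (T y) - Cs (T z)| <= `|Cs y - Cs z|.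
Proof.
move=> monA y z.
have := monA _ _ _ _ (resolvent_residual y) (resolvent_residual z).
have -> : M y - M (T y) - (M z - M (T z)) = M ((y - z) - (T y - T z)).
  by rewrite !(linearB M)/= !opprD addrACA.
rewrite innerC -/(minner M _ _) minnerE.
rewrite (linearB Cs (y - z)) innerC innerBr inner_normE => firm.
have := sqr_ge0 `|Cs (y - z) - Cs (T y - T z)|.
rewrite sqr_normB (innerC (Cs (y - z))) => sq.
rewrite -!(linearB Cs) -(ler_pXn2r (isT : (0 < 2)%N)) ?nnegrE//; lra.
Qed.

Lemma resolvent_lipschitz L : lipschitz_op L (inv_op (add_op M A)) -> 0 <= L ->
  forall y z, `|T y - T z| <= L * op_norm C * `|Cs y - Cs z|.
Proof.
move=> lipL L0 y z.
apply: le_trans (lipL _ _ _ _ (resolvent_mem y) (resolvent_mem z)) _.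
case: hC => bC _ _ ME; rewrite !ME -mulrA ler_wpM2l// -linearB.
exact: op_norm_ge.
Qed.

(** A negative constant would force [M + A] to have a single value over all of
    the range of [M], hence [M] to vanish. *)
Lemma lipschitz_const_ge0 L z : lipschitz_op L (inv_op (add_op M A)) ->
  mnorm M z != 0 -> 0 <= L.
Proof.
move=> lipL z0.
have Mz : 0 < `|M z|.
  rewrite normr_gt0; apply: contra_neq z0 => Mz.
  by rewrite /mnorm /minner Mz linear0l sqrtr0.
have := le_trans (normr_ge0 _)
  (lipL _ _ _ _ (resolvent_mem z) (resolvent_mem 0)).
by rewrite linear0 subr0 pmulr_lge0.
Qed.

End Preconditioned.

(** * The convergence rates *)

Theorem corollary3p2 (R : realType) (H D : hilbertType R)
    (A : H -> set H) (M : {linear H -> H})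
    (C : {linear D -> H}) (Cs : {linear H -> D}) (L : R)
    (T : H -> H) (x : nat -> H) (xstar : H)
    (hA : maximal_monotone A)
    (hzer : zer A !=set0)
    (hM : admissible_preconditioner A M)
    (hC : is_decomposition M C Cs)
    (hL : lipschitz_op L (inv_op (add_op M A)))
    (hT : forall z : H, inv_op (add_op M A) (M z) = [set T z])
    (hdef : pha_defined M T x)
    (hx : pha_iteration M T x)
    (hxstar : zer A xstar) :
  let phi := pha_param M T x in
  let bM := pha_bound M T x in
  let L' := L * op_norm C in
  (forall k, (1 <= k)%N ->
     mnorm M (x k - T (x k)) <= 2 / (phi k + 1) * mnorm M (x 0%N - xstar)) /\
  (forall k, (2 <= k)%N ->
     `|x k - T (x k)| <= bM * (L' + 1) / (phi k + 1)
       + 2 * L' / (phi k.-1 + 1) * mnorm M (x 0%N - xstar)).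
Proof.
move=> phi bM L'.
have [bC _ _ _] := hC.
have L0 : 0 <= L := lipschitz_const_ge0 hT hL (hdef 1%N isT).
have L'0 : 0 <= L' by rewrite mulr_ge0// op_norm_ge0.
have lipT y z : `|T y - T z| <= L' * `|Cs y - Cs z|
  by exact: (resolvent_lipschitz hT hC hL L0).
have nonexp := resolvent_nonexpansive hT hC hA.1.
have Tp : T xstar = xstar := zer_fixed hT hxstar.
pose u k := Cs (x k); pose v k := Cs (T (x k)); pose p := Cs xstar.
have res_neq0 k : `|u k - v k| != 0.
  by have := hdef k.+1 isT; rewrite (mnormE hC) linearB.
have phiE k :
    phi k.+1 = 2 * '<u k - v k, u 0%N - u k> / `|u k - v k| ^+ 2 + 1.
  by rewrite /phi /pha_param (minnerE hC) (mnormE hC) !linearB.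
have iterE k : u k.+1 = (1 / (phi k.+1 + 1)) *: u 0%N
                        + (phi k.+1 / (phi k.+1 + 1)) *: v k.
  by rewrite /u hx// linearD !linearZ.
have nonexpuv j k : `|v j - v k| <= `|u j - u k| by exact: nonexp.
have fixuv k : `|v k - p| <= `|u k - p|.
  by have := nonexp (x k) xstar; rewrite Tp.
have phi1 k : 1 <= phi k.+1 := anchor_ge1 res_neq0 phiE iterE nonexpuv k.
have dist k : `|u k - p| <= `|u 0%N - p| :=
  halpern_dist_le res_neq0 phiE iterE nonexpuv fixuv k.
have rate k : (1 <= k)%N ->
    mnorm M (x k - T (x k)) <= 2 / (phi k + 1) * mnorm M (x 0%N - xstar).
  case: k => // k _; rewrite !(mnormE hC) !linearB.
  exact: (halpern_residual_le res_neq0 phiE iterE nonexpuv fixuv).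
split=> // -[//|[//|k]] _ /=.
(* Bounds relative to [xstar] show that [sup] is taken over a bounded set,
   so that [bM] dominates its elements. *)
have bounded j : (1 <= j)%N ->
    Num.max (mnorm M (x 0%N - x j)) `|x 0%N - T (x j)| <= bM.
  move=> j1; apply: ub_le_sup; last by exists j.
  exists (Num.max (2 * `|u 0%N - p|)
                  (`|x 0%N - xstar| + L' * `|u 0%N - p|)) => _ [i _ <-].
  rewrite ge_max !le_max; apply/andP; split; apply/orP; [left|right].
    rewrite (mnormE hC) linearB -/(u _) -/(u _).
    apply: le_trans (ler_distD p _ _) _; have := dist i.
    by rewrite (distrC p); lra.
  apply: le_trans (ler_distD xstar _ _) _; rewrite lerD2l.
  rewrite -{1}Tp; apply: le_trans (lipT _ _) _.
  by rewrite ler_wpM2l// distrC dist.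
have := bounded k.+2 isT; rewrite ge_max => /andP[_ bT].
have := bounded k.+1 isT; rewrite ge_max (mnormE hC) => /andP[bu _].
have := rate k.+1 isT; rewrite [X in X <= _](mnormE hC) => ratek.
set s := phi k.+2; have s1 : 1 <= s := phi1 k.+1.
have sp : 0 < s + 1 by lra.
(* The weight [s / (s + 1)] is at most one and can be dropped. *)
have average_le (V : normedModType R) (a b c : V) :
    `|(1 / (s + 1)) *: a + (s / (s + 1)) *: b - c|
    <= `|a - c| / (s + 1) + `|b - c|.
  apply: le_trans (norm_average_le _ _ _ _) _; first lra.
  rewrite mulrDl lerD2l ler_pdivrMr//.
  by have := normr_ge0 (b - c); nra.
have resx : `|x k.+2 - T (x k.+2)|
    <= `|x 0%N - T (x k.+2)| / (s + 1) + `|T (x k.+1) - T (x k.+2)|.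
  by rewrite {1}(hx k.+2 isT) average_le.
have stepu : `|u k.+2 - u k.+1|
    <= `|u 0%N - u k.+1| / (s + 1) + `|v k.+1 - u k.+1|.
  by rewrite {1}iterE average_le.
apply: le_trans resx _.
apply: le_trans (lerD (ler_wpM2r _ bT) (lipT _ _)) _.
  by rewrite invr_ge0 ltW.
rewrite -/(u _) -/(u _) [`|u _ - u _|]distrC.
have du : `|u k.+2 - u k.+1|
    <= bM / (s + 1) + 2 / (phi k.+1 + 1) * mnorm M (x 0%N - xstar).
  apply: le_trans stepu _; apply: lerD.
    by rewrite ler_pM2r ?invr_gt0//; rewrite linearB in bu.
  by rewrite distrC; rewrite linearB in ratek.
have := ler_wpM2l L'0 du; lra.
Qed.
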